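(* Let $G=([n],E)$ be a simple graph and let $\mathcal{A}=\mathcal{A}_G$ be the graphical arrangement induced by $G$ in $V=\mathbb{K}^n$, with rank $r$ and intersection lattice $L(\mathcal{A})$. Suppose that $\pi$ is a nice partition of $\mathcal{A}$. Then there is a maximal modular chain $V=X_0<X_1<\dots<X_r=T$ of $L(\mathcal{A})$ such that $\pi=\{\pi_1,\ldots,\pi_r\}$ with $\pi_i=\mathcal{A}_{X_i}\setminus\mathcal{A}_{X_{i-1}}$ for $1\le i\le r$.
   Context: $\mathbb{K}$ is a field and $[n]=\{1,\dots,n\}$. For a simple graph $G=([n],E)$, the graphical arrangement induced by $G$ is the finite set of hyperplanes $\mathcal{A}_G=\{H_{ij}: x_i-x_j=0 \mid ij\in E\}$ in $V=\mathbb{K}^n$. For a central hyperplane arrangement $\mathcal{A}$ in $V=\mathbb{K}^n$ (a finite set of linear hyperplanes), $L(\mathcal{A})$ is the set of all intersections of hyperplanes in $\mathcal{A}$ (including $V$ as the empty intersection), ordered by reverse inclusion. Its minimum is $V$ and its maximum is $T=\bigcap_{H\in\mathcal{A}}H$. It is a geometric lattice with rank function $r(X)=n-\dim X$, and the rank of $\mathcal{A}$ is $r=r(T)$. Join is $X\vee Y=X\cap Y$ and meet $X\wedge Y$ is the intersection of all $Z\in L(\mathcal{A})$ with $X,Y\subseteq Z$. For $X\in L(\mathcal{A})$, the localization is $\mathcal{A}_X=\{H\in\mathcal{A}\mid X\subseteq H\}$. An element $X\in L(\mathcal{A})$ is modular if $r(X)+r(Y)=r(X\vee Y)+r(X\wedge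 Y)$ for all $Y\in L(\mathcal{A})$. A maximal modular chain is a maximal chain $V=X_0<X_1<\dots<X_r=T$ of $L(\mathcal{A})$ all of whose elements are modular. Let $\pi=\{\pi_1,\dots,\pi_l\}$ be a set partition of $\mathcal{A}$ (pairwise disjoint nonempty parts with union $\mathcal{A}$; unordered). A $p$-section of $\pi$ ($p\ge 0$) is a $p$-tuple $(H_1,\dots,H_p)$ of hyperplanes of $\mathcal{A}$ such that $H_a$ and $H_b$ lie in different parts of $\pi$ whenever $a\ne b$ (the empty tuple is the $0$-section). A $p$-tuple is independent if $r(\bigcap_{i=1}^pH_i)=p$; $\pi$ is independent if all its $p$-sections, for all $p\ge0$, are independent. The partition $\pi$ is nice if it is independent and for every $X\in L(\mathcal{A})\setminus\{V\}$ there is some $i$ with $|\pi_i\cap\mathcal{A}_X|=1$. *)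

(* Defs.v *)
From HB Require Import structures.
From mathcomp Require Import all_boot all_order all_algebra.
From mathcomp Require Import finmap.

Set Implicit Arguments.
Unset Strict Implicit.
Unset Printing Implicit Defensive.

Import GRing.Theory.
Local Open Scope ring_scope.
Local Open Scope fset_scope.

(* K^n is 'rV[K]_n. The field may be infinite, so a finite set of subspaces   *)
(* is an {fset _} over the choice type of subspaces, not a {set _}.           *)
Notation subspace K n := {vspace 'rV[K]_n}.

Section Arrangement.
Variables (K : fieldType) (n : nat).
Implicit Types (A : {fset subspace K n}) (X Y Z H : subspace K n).
Implicit Types (C D P Q : {fset subspace K n}).
Implicit Types (pi : {fset {fset subspace K n}}).

Definition rk X : nat := (n - \dim X)%N.

(* The intersection over the empty family is the whole space. *)
Definition inter_lattice A : {fset subspace K n} :=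
  [fset (\bigcap_(H <- B) H)%VS | B : {fset subspace K n} in fpowerset A].

Definition arr_max A : subspace K n := (\bigcap_(H <- A) H)%VS.

Definition arr_rank A : nat := rk (arr_max A).

(* Reverse inclusion. *)
Definition le_lat X Y : bool := (Y <= X)%VS.
Definition lt_lat X Y : bool := le_lat X Y && (X != Y).

Definition join_lat X Y : subspace K n := (X :&: Y)%VS.
Definition meet_lat A X Y : subspace K n :=
  (\bigcap_(Z <- inter_lattice A | (X <= Z)%VS && (Y <= Z)%VS) Z)%VS.

Definition localization A X : {fset subspace K n} :=
  [fset H in A | (X <= H)%VS].

Definition modular A X : Prop :=
  X \in inter_lattice A /\
  forall Y, Y \in inter_lattice A ->
    (rk X + rk Y = rk (join_lat X Y) + rk (meet_lat A X Y))%N.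

Definition chain A C : Prop :=
  C `<=` inter_lattice A /\
  {in C &, forall X Y, le_lat X Y \/ le_lat Y X}.

Definition maximal_chain A C : Prop :=
  chain A C /\ forall D, chain A D -> C `<=` D -> D = C.

(* Only the values X 0, ..., X r, with r the rank of A, are relevant. *)
Definition maximal_modular_chain A (X : nat -> subspace K n) : Prop :=
  let r := arr_rank A in
  [/\ X 0%N = fullv,
      X r = arr_max A,
      forall i, (i < r)%N -> lt_lat (X i) (X i.+1),
      maximal_chain A [fset X i | i in iota 0 r.+1]
    & forall i, (i <= r)%N -> modular A (X i)].

Definition is_partition A pi : Prop :=
  [/\ fset0 \notin pi,
      {in pi &, forall P Q, P != Q -> [disjoint P & Q]}
    & fcover pi = A].

Definition is_section pi (p : nat) (t : p.-tuple (subspace K n)) A : Prop :=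
  (forall a, tnth t a \in A) /\
  forall a b, a != b -> exists P Q,
    [/\ P \in pi, Q \in pi, P != Q, tnth t a \in P & tnth t b \in Q].

Definition independent_tuple (p : nat) (t : p.-tuple (subspace K n)) : Prop :=
  rk (\bigcap_(i < p) tnth t i)%VS = p.

Definition independent_partition A pi : Prop :=
  forall (p : nat) (t : p.-tuple (subspace K n)),
    is_section pi t A -> independent_tuple t.

Definition nice_partition A pi : Prop :=
  [/\ is_partition A pi,
      independent_partition A pi
    & forall X, X \in inter_lattice A -> X != fullv ->
        exists P, P \in pi /\ #|` P `&` localization A X| = 1%N].

Definition coord_diff (i j : 'I_n) (x : 'rV[K]_n) : K^o := x 0 i - x 0 j.

Fact coord_diff_is_linear i j : linear (coord_diff i j).
Proof.
by move=> a u v; rewrite /coord_diff !mxE /GRing.scale /= mulrBr opprD addrACA.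
Qed.

HB.instance Definition _ i j :=
  GRing.isLinear.Build K 'rV[K]_n K^o _ (coord_diff i j)
    (coord_diff_is_linear i j).

Definition hyperplane (i j : 'I_n) : subspace K n :=
  lker (linfun (coord_diff i j)).

Lemma mem_hyperplane i j (x : 'rV[K]_n) :
  (x \in hyperplane i j) = (x 0 i - x 0 j == 0).
Proof. by rewrite memv_ker lfunE. Qed.

Definition graphical_arrangement (E : rel 'I_n) : {fset subspace K n} :=
  [fset hyperplane ij.1 ij.2 | ij : 'I_n * 'I_n & E ij.1 ij.2].

Lemma graphical_arrangementP (E : rel 'I_n) H :
  reflect (exists i j, E i j /\ H = hyperplane i j)
          (H \in graphical_arrangement E).
Proof.
apply: (iffP (imfsetP _ _ _ _)) => /= [[[i j]]|[i [j [Eij ->]]]].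
  by rewrite !inE /= => Eij ->; exists i, j.
by exists (i, j); rewrite ?inE.
Qed.

End Arrangement.

Arguments graphical_arrangement K {n} E.

(* Main.v *)
Require Import Defs.
From mathcomp Require Import all_boot all_order all_algebra.
From mathcomp Require Import finmap zify.

(** Call the parts of pi colours, so that pi is an edge colouring of G.
    Niceness enters through two consequences.

    - Niceness at rank 2 flats ([part_triangle]): two edges of the same colour
      share a vertex and span a triangle of G whose third edge has another
      colour. Hence every colour class is a star with pairwise adjacent leaves.
    - Independence ([no_rainbow_closed_walk]): no closed walk has its steps in
      pairwise different colours, because the equations along a closed walk are
      linearly dependent.

    The heart of the proof is that some colour class P is a cut: it consists of
    all the edges between some vertex set S and its complement
    ([topmost_part_cut]). Say that a colour Q is above P if a triangle has two
    edges of colour Q and the third of colour P. If the ends u, w of an edge of P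
    are joined by a walk avoiding P, take a shortest one. It cannot be rainbow,
    so it repeats a colour Q, and its minimality forces a triangle which shows
    that Q is above P ([triangle_above_of_walk]). So a class with no colour above
    it is a cut. Such a class exists ([exists_topmost_part]): otherwise some
    colours would lie cyclically above one another, and the centres of these
    stars would form a rainbow closed walk.

    When P is a cut, the indicator vector v of S lies in all the hyperplanes of
    A \ P and in none of P. Let T' be the intersection of A \ P. For each flat Y,
    either Y contains T' or T' + Y = Y + <[v]>, and this is again a flat; so T'
    is a modular coatom ([sum_modular_coatom]), whose localization is A \ P.
    Modularity in A \ P passes to A ([sum_modularD]), and pi minus P is nice for
    A \ P ([nice_partition_coatom]), which is graphical; induction on the
    number of colours gives the chain. *)

Set Implicit Arguments.
Unset Strict Implicit.
Unset Printing Implicit Defensive.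

Import GRing.Theory.
Local Open Scope ring_scope.
Local Open Scope fset_scope.

(** * The lattice of flats *)

Lemma mem_imfset_iota (T : choiceType) (f : nat -> T) a b y :
  reflect (exists2 i, (a <= i < a + b)%N & y = f i)
          (y \in [fset f i | i in iota a b]).
Proof.
apply: (iffP (imfsetP _ _ _ _)) => -[i]; first by rewrite mem_iota; exists i.
by exists i; rewrite // mem_iota.
Qed.

Section Lattice.
Variables (K : fieldType) (n : nat).
Implicit Types (A B P : {fset subspace K n}) (X Y Z H U : subspace K n).

Local Notation cap B := (\bigcap_(H <- B) H)%VS.

Lemma subv_bigcap_seq U (s : seq (subspace K n)) :
  (U <= cap s)%VS = all (fun H => (U <= H)%VS) s.
Proof.
elim: s => [|H s IHs] /=; first by rewrite big_nil subvf.
by rewrite big_cons subv_cap IHs.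
Qed.

Lemma subv_capP U B :
  reflect {in B, forall H, (U <= H)%VS} (U <= cap B)%VS.
Proof. by rewrite subv_bigcap_seq; apply: allP. Qed.

Lemma cap_subv B H : H \in B -> (cap B <= H)%VS.
Proof. by move: H; apply/subv_capP. Qed.

Lemma mem_inter_lattice A X :
  reflect (exists2 B, B `<=` A & X = cap B) (X \in inter_lattice A).
Proof.
apply: (iffP (imfsetP _ _ _ _)) => /= [[B]|[B sBA ->]].
  by rewrite fpowersetE => sBA ->; exists B.
by exists B => //; rewrite fpowersetE.
Qed.

Lemma mem_localization A X H :
  (H \in localization A X) = (H \in A) && (X <= H)%VS.
Proof. by rewrite !inE. Qed.

Lemma localization_sub A X : localization A X `<=` A.
Proof. by apply/fsubsetP=> H; rewrite mem_localization => /andP[]. Qed.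

Lemma lattice_cap_localization A X :
  X \in inter_lattice A -> X = cap (localization A X).
Proof.
case/mem_inter_lattice=> B sBA defX; apply/eqP; rewrite eqEsubv.
apply/andP; split.
  by apply/subv_capP=> H; rewrite mem_localization => /andP[].
rewrite {2}defX; apply/subv_capP=> H HB; apply: cap_subv.
by rewrite mem_localization (fsubsetP sBA) //= defX cap_subv.
Qed.

Lemma fullv_in_lattice A : fullv \in inter_lattice A.
Proof.
by apply/mem_inter_lattice; exists fset0; rewrite ?fsub0set // big_nil.
Qed.

Lemma arr_max_in_lattice A : arr_max A \in inter_lattice A.
Proof. by apply/mem_inter_lattice; exists A. Qed.

Lemma localization_arr_max A : localization A (arr_max A) = A.
Proof.
apply/fsetP=> H; rewrite mem_localization andb_idr //; exact: cap_subv.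
Qed.

Lemma inter_latticeS A B : A `<=` B -> inter_lattice A `<=` inter_lattice B.
Proof.
move=> sAB; apply/fsubsetP=> X /mem_inter_lattice[C sCA ->].
by apply/mem_inter_lattice; exists C => //; apply: fsubset_trans sAB.
Qed.

Lemma arr_max_sub A X : X \in inter_lattice A -> (arr_max A <= X)%VS.
Proof.
case/mem_inter_lattice=> B /fsubsetP sBA ->; apply/subv_capP=> H /sBA.
exact: cap_subv.
Qed.

Lemma dimv_le X : (\dim X <= n)%N.
Proof. by have := dimvS (subvf X); rewrite dimvf /dim /= mul1n. Qed.

(** Since dim X + dim Y = dim (X :&: Y) + dim (X + Y) and the meet of X and Y
    contains X + Y, modularity of X amounts to the meet being X + Y, that is, to
    X + Y being a flat. This form makes transitivity of modularity a one-line
    computation with sums (see [sum_modularD]). *)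
Definition sum_modular A X :=
  X \in inter_lattice A /\
  {in inter_lattice A, forall Y, (X + Y)%VS \in inter_lattice A}.

Lemma sum_modular_modular A X : sum_modular A X -> modular A X.
Proof.
case=> XL sumL; split=> // Y YL.
have ->: meet_lat A X Y = (X + Y)%VS.
  apply/eqP; rewrite eqEsubv; apply/andP; split.
    rewrite /meet_lat (big_rem (X + Y)%VS) /=; last exact: sumL.
    by rewrite addvSl addvSr capvSl.
  rewrite /meet_lat; elim/big_ind: _ => [|U V sU sV|Z].
  - exact: subvf.
  - by move=> *; rewrite subv_cap sU sV.
  - by rewrite subv_add.
have := dimv_sum_cap X Y; rewrite /rk /join_lat.
have := dimv_le (X + Y)%VS; have := dimv_le (X :&: Y)%VS.
have := dimv_le X; have := dimv_le Y; lia.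
Qed.

(** The r strict steps raise the rank from 0 to r, so the i-th flat has rank
    exactly i; a flat comparable with the chain member of its own rank is equal
    to it. *)
Lemma strict_chain_maximal A (X : nat -> subspace K n) :
  X 0%N = fullv -> X (arr_rank A) = arr_max A ->
  (forall i, (i < arr_rank A)%N -> lt_lat (X i) (X i.+1)) ->
  (forall i, (i <= arr_rank A)%N -> X i \in inter_lattice A) ->
  maximal_chain A [fset X i | i in iota 0 (arr_rank A).+1].
Proof.
set r := arr_rank A => X0 Xr ltX XL.
have mono i j : (i <= j <= r)%N ->
    (X j <= X i)%VS /\
    (j - i <= rk (X j) - rk (X i))%N /\ (rk (X i) <= rk (X j))%N.
  case/andP=> + le_jr; elim: j le_jr => [|j IHj] lt_jr.
    by rewrite leqn0 => /eqP->; rewrite subvv; split=> //; lia.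
  rewrite leq_eqVlt => /predU1P[->|]; first by rewrite subvv; split=> //; lia.
  rewrite ltnS => le_ij; have [sji rji] := IHj (ltnW lt_jr) le_ij.
  have /andP[sjj neq] := ltX j lt_jr; rewrite /le_lat in sjj.
  split; first exact: subv_trans sjj sji.
  have: (\dim (X j.+1) < \dim (X j))%N.
    rewrite ltn_neqAle dimvS // andbT eqn_leq dimvS //=.
    by apply: contra neq => le; rewrite eq_sym eqEdim sjj.
  move: rji; rewrite /rk; have := dimv_le (X j); lia.
have rkX i : (i <= r)%N -> rk (X i) = i.
  move=> le_ir; have [_ +] := mono 0%N i le_ir.
  have le_irr : (i <= r <= r)%N by rewrite le_ir leqnn.
  have [_ +] := mono i r le_irr.
  have -> : rk (X r) = r by rewrite Xr.
  have: rk (X 0%N) = 0%N by rewrite X0 /rk dimvf /dim /= mul1n subnn.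
  lia.
split.
  split.
    by apply/fsubsetP=> Y /mem_imfset_iota[i lt_ir ->]; apply: XL.
  move=> Y Z /mem_imfset_iota[i lt_ir ->] /mem_imfset_iota[j lt_jr ->].
  rewrite /le_lat; case: (leqP i j) => [le_ij|/ltnW le_ji]; [left|right].
    by case: (mono i j) => //; lia.
  by case: (mono j i) => //; lia.
move=> D [/fsubsetP sDL chD] sCD; apply/eqP; rewrite eqEfsubset sCD andbT.
apply/fsubsetP=> Y YD.
have le_Yr : (rk Y <= r)%N.
  by rewrite /r /arr_rank /rk leq_sub2l // dimvS // arr_max_sub // sDL.
apply/mem_imfset_iota; exists (rk Y) => //.
have XD : X (rk Y) \in D.
  by apply: (fsubsetP sCD); apply/mem_imfset_iota; exists (rk Y).
have eqd : \dim (X (rk Y)) = \dim Y.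
  move: (X (rk Y)) (rkX _ le_Yr) => Z; rewrite /rk.
  by have := dimv_le Y; have := dimv_le Z; lia.
have [le|le] := chD _ _ YD XD; apply/eqP; rewrite /le_lat in le.
  by rewrite eq_sym eqEdim le eqd /=.
by rewrite eqEdim le eqd /=.
Qed.

End Lattice.

(** * Splitting off a modular coatom *)

(** In graph terms: P is the set of edges between a vertex set S and its
    complement, v is the indicator vector of S, and any two of these edges
    span a triangle whose third edge stays inside S or inside its complement.
    The conditions on v and on pairs in P express this for an arbitrary
    arrangement; they make A \ P the localization at a modular coatom. *)
Definition modular_cut (K : fieldType) (n : nat) (A P : {fset subspace K n})
    (v : 'rV[K]_n) : Prop :=
  [/\ P `<=` A, P != fset0,
      {in A `\` P, forall H : subspace K n, v \in H},
      {in P, forall H : subspace K n, v \notin H /\ (H + <[v]>)%VS = fullv}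
    & {in P &, forall H1 H2, H1 != H2 ->
        exists2 H3, H3 \in A `\` P &
          (H1 :&: H2 <= H3)%VS /\ (H1 :&: H3 <= H2)%VS}].

(** Maximality of the chain is left out: it follows from the other conditions by
    [strict_chain_maximal], and need not be carried through the induction. *)
Definition modular_filtration (K : fieldType) (n : nat) (A : {fset subspace K n})
    (pi : {fset {fset subspace K n}}) (X : nat -> subspace K n) : Prop :=
  [/\ X 0%N = fullv, X (arr_rank A) = arr_max A,
      forall i, (i < arr_rank A)%N -> lt_lat (X i) (X i.+1),
      forall i, (i <= arr_rank A)%N -> sum_modular A (X i)
    & pi = [fset localization A (X i) `\` localization A (X i.-1)
            | i in iota 1 (arr_rank A)]].

Section ModularCoatom.
Variables (K : fieldType) (n : nat) (A P : {fset subspace K n}) (v : 'rV[K]_n).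
Implicit Types (X Y Z H : subspace K n).

Hypothesis cutP : modular_cut A P v.

Let sPA : P `<=` A. Proof. by case: cutP. Qed.
Let P_neq0 : P != fset0. Proof. by case: cutP. Qed.
Let vA' : {in A `\` P, forall H, v \in H}. Proof. by case: cutP. Qed.
Let vP : {in P, forall H, v \notin H}.
Proof. by case: cutP => _ _ _ cutH _ H /cutH[]. Qed.
Let hypP : {in P, forall H, (H + <[v]>)%VS = fullv}.
Proof. by case: cutP => _ _ _ cutH _ H /cutH[]. Qed.
Let lineP : {in P &, forall H1 H2, H1 != H2 ->
  exists2 H3, H3 \in A `\` P & (H1 :&: H2 <= H3)%VS /\ (H1 :&: H3 <= H2)%VS}.
Proof. by case: cutP. Qed.

(** Every flat of A \ P contains v, which no hyperplane of P does. *)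
Lemma localization_coatom X :
  X \in inter_lattice (A `\` P) -> localization (A `\` P) X = localization A X.
Proof.
move/arr_max_sub=> sTX; apply/fsetP=> H; rewrite !mem_localization inE.
apply/andb_id2r => sXH; rewrite andb_idl // => _.
apply: contraL (subv_trans sTX sXH) => /vP vH; apply: contra vH => /subvP; apply.
by rewrite memvE; apply/subv_capP=> H' /vA'; rewrite -memvE.
Qed.

(** Removing from a flat Y <= H0 the constraints that belong to P frees just one
    dimension, in the direction v: by the triangle condition, each further
    member of P is implied by H0 and a hyperplane through Y outside P. *)
Lemma arr_max_localizationD Y H0 :
  H0 \in P -> (Y <= H0)%VS -> Y \in inter_lattice A ->
  arr_max (localization A Y `\` P) = (Y + <[v]>)%VS.
Proof.
move=> PH0 sYH0 /lattice_cap_localization defY.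
apply/eqP; rewrite eqEsubv; apply/andP; split; last first.
  rewrite subv_add; apply/andP; split; apply/subv_capP=> H; rewrite inE.
    by rewrite mem_localization => /and3P[].
  case/andP=> nPH /(fsubsetP (localization_sub _ _)) AH.
  by rewrite -memvE vA' // inE nPH.
apply/subvP=> x /[!memvE] xZ.
have: x \in (H0 + <[v]>)%VS by rewrite hypP ?memvf.
case/memv_addP=> y yH0 [_ /vlineP[c ->] def_x].
rewrite -memvE def_x memv_add ?memvZ ?memv_line //.
have yZ: (<[y]> <= arr_max (localization A Y `\` P))%VS.
  have ->: y = x - c *: v by rewrite def_x addrK.
  rewrite -memvE rpredB // memvE //; apply/subv_capP=> H; rewrite inE => /andP[nPH].
  move/(fsubsetP (localization_sub _ _)) => AH.
  by rewrite -memvE memvZ // vA' // inE nPH.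
rewrite defY memvE; apply/subv_capP=> H HY.
have [PH | nPH] := boolP (H \in P); last first.
  by apply: subv_trans yZ _; apply: cap_subv; rewrite inE nPH.
have [<-|neqH] := eqVneq H0 H; first by rewrite -memvE.
have [H3 A'H3 [s3 s]] := lineP PH0 PH neqH.
apply: subv_trans s; rewrite subv_cap -[(_ <= H0)%VS]memvE yH0 /=.
apply: subv_trans yZ _; apply: cap_subv.
move: A'H3; rewrite !inE => /andP[-> ->] /=; apply: subv_trans s3.
by rewrite subv_cap sYH0; move: HY; rewrite mem_localization => /andP[].
Qed.

Let inter_latticeD : inter_lattice (A `\` P) `<=` inter_lattice A.
Proof. by apply: inter_latticeS; apply: fsubsetDl. Qed.

Lemma memv_coatom : v \in arr_max (A `\` P).
Proof. by rewrite memvE; apply/subv_capP=> H /vA'; rewrite -memvE. Qed.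

(** A flat Y lying in no hyperplane of P contains the coatom T'; for
    any other one, T' + Y = Y + <[v]> is a flat by [arr_max_localizationD]. *)
Lemma sum_modular_coatom : sum_modular A (arr_max (A `\` P)).
Proof.
split; first by apply: (fsubsetP inter_latticeD); apply: arr_max_in_lattice.
move=> Y YL; have [dis | /fset0Pn[H0]] := eqVneq (localization A Y `&` P) fset0.
  suff /addv_idPr->: (arr_max (A `\` P) <= Y)%VS by [].
  rewrite (lattice_cap_localization YL); apply/subv_capP=> H HY.
  apply: cap_subv; rewrite inE (fsubsetP (localization_sub _ _) _ HY) andbT.
  by apply/negP=> PH; have := in_fset0 H; rewrite -dis inE HY PH.
rewrite inE mem_localization => /andP[/andP[AH0 sYH0] PH0].
have defYv := arr_max_localizationD PH0 sYH0 YL.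
suff ->: (arr_max (A `\` P) + Y = Y + <[v]>)%VS.
  rewrite -defYv; apply/mem_inter_lattice; exists (localization A Y `\` P) => //.
  exact: fsubset_trans (fsubsetDl _ _) (localization_sub _ _).
apply/eqP; rewrite eqEsubv !subv_add addvSl addvSr /=.
have -> /= : (<[v]> <= arr_max (A `\` P) + Y)%VS.
  by apply: subv_trans (addvSl _ _); rewrite -memvE memv_coatom.
rewrite !andbT -defYv; apply/subv_capP=> H; rewrite inE mem_localization.
by case/and3P=> nPH AH _; apply: cap_subv; rewrite inE nPH.
Qed.

(** X contains T' = arr_max (A \ P), so X + Y = X + (T' + Y), where T' + Y is
    a flat of A by modularity of T', and in fact a flat of A \ P. *)
Lemma sum_modularD X : sum_modular (A `\` P) X -> sum_modular A X.
Proof.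
case=> XL modX; split; first exact: (fsubsetP inter_latticeD).
move=> Y YL; have [_ /(_ Y YL)] := sum_modular_coatom.
set T' := arr_max _ => TYL.
have <-: (X + (T' + Y) = X + Y)%VS.
  by rewrite addvA; congr (_ + _)%VS; apply/addv_idPl/arr_max_sub.
apply/(fsubsetP inter_latticeD)/modX/mem_inter_lattice.
exists (localization A (T' + Y)%VS); last exact: lattice_cap_localization.
apply/fsubsetP=> H; rewrite mem_localization inE => /andP[AH sTH].
rewrite AH andbT; apply: contraL (subv_trans (addvSl _ _) sTH) => /vP vH.
by apply: contra vH => /subvP; apply; exact: memv_coatom.
Qed.

Lemma arr_max_coatom : arr_max (A `\` P) = (arr_max A + <[v]>)%VS.
Proof.
have /fset0Pn[H0 PH0] := P_neq0.
rewrite -(arr_max_localizationD PH0) ?localization_arr_max //.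
  by apply: cap_subv; apply: (fsubsetP sPA).
exact: arr_max_in_lattice.
Qed.

Lemma notin_arr_max_coatom : v \notin arr_max A.
Proof.
have /fset0Pn[H0 PH0] := P_neq0; apply: contra (vP PH0).
by apply/subvP/cap_subv/(fsubsetP sPA).
Qed.

Lemma arr_rank_coatom : arr_rank A = (arr_rank (A `\` P)).+1.
Proof.
have vT := notin_arr_max_coatom; rewrite /arr_rank arr_max_coatom /rk.
have /dimv_disjoint_sum dimT : (arr_max A :&: <[v]> = 0)%VS.
  apply/eqP; rewrite -subv0; apply/subvP=> x; rewrite memv_cap => /andP[xT].
  case/vlineP=> c def_x; rewrite memv0 def_x; have [->|c0] := eqVneq c 0.
    by rewrite scale0r.
  by case/negP: vT; rewrite -[v](scalerK c0) -def_x memvZ.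
have := dimv_le (arr_max A + <[v]>)%VS; rewrite dimT dim_vline.
have -> /= : v != 0 by apply: contraNneq vT => ->; apply: mem0v.
lia.
Qed.

Lemma lt_lat_coatom : lt_lat (arr_max (A `\` P)) (arr_max A).
Proof.
rewrite /lt_lat /le_lat arr_max_coatom addvSl /=.
apply: contraNneq notin_arr_max_coatom => <-.
by rewrite memvE addvSr.
Qed.

Lemma nice_partition_coatom (pi : {fset {fset subspace K n}}) :
  P \in pi -> nice_partition A pi -> nice_partition (A `\` P) (pi `\ P).
Proof.
move=> piP [[pi0 dis cov] indep nice].
have mem_pi Q : Q \in pi `\ P -> Q \in pi by rewrite !inE => /andP[].
split; first split.
- by apply: contra pi0 => /mem_pi.
- by move=> Q Q' /mem_pi piQ /mem_pi piQ'; apply: dis.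
- apply/fsetP=> H; apply/bigfcupP/idP=> [[Q /andP[]]|].
    rewrite !inE => /andP[neq piQ] _ HQ; rewrite -cov; apply/andP; split.
      have /fdisjointP disQP := dis _ _ piQ piP neq.
      exact: disQP.
    by apply/bigfcupP; exists Q; rewrite ?piQ.
  rewrite inE -cov => /andP[nPH /bigfcupP[Q /andP[piQ _] HQ]].
  by exists Q; rewrite // andbT !inE piQ andbT; apply: contraNneq nPH => <-.
- move=> p t [tA tpi]; apply: indep; split=> [a|a b /tpi].
    by have := tA a; rewrite inE => /andP[].
  by move=> [Q [R [/mem_pi piQ /mem_pi piR neq Qa Rb]]]; exists Q, R.
move=> X XL Xneq.
have [Q [piQ card]] := nice X (fsubsetP inter_latticeD _ XL) Xneq.
exists Q; rewrite localization_coatom // !inE piQ andbT; split=> //.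
apply: contra_eqN card => /eqP->; rewrite -localization_coatom //.
suff -> : P `&` localization (A `\` P) X = fset0 by rewrite cardfs0.
by apply/fsetP=> H; rewrite !inE; case: (H \in P).
Qed.

(** The filtration of A \ P is prolonged by the maximum of A; the part that this
    last step contributes is P. *)
Lemma modular_filtration_coatom (pi : {fset {fset subspace K n}})
    (X : nat -> subspace K n) :
    P \in pi -> modular_filtration (A `\` P) (pi `\ P) X ->
  exists X' : nat -> subspace K n, modular_filtration A pi X'.
Proof.
move=> piP [X0 Xr ltX modX defpi]; have rkA := arr_rank_coatom.
set r := arr_rank (A `\` P) in rkA Xr ltX modX defpi.
pose X' i := if (i <= r)%N then X i else arr_max A.
have X'E i : (i <= r)%N -> X' i = X i by rewrite /X' => ->.
have X'r : X' r.+1 = arr_max A by rewrite /X' ltnn.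
have locE i : (i <= r)%N -> localization A (X' i) = localization (A `\` P) (X i).
  by move=> le_ir; rewrite X'E // localization_coatom //; case: (modX i le_ir).
exists X'; split; rewrite ?rkA //.
- move=> i; rewrite ltnS leq_eqVlt => /predU1P[->|lt_ir].
    by rewrite X'r X'E // Xr lt_lat_coatom.
  by rewrite !X'E ?ltX // ltnW.
- move=> i; rewrite leq_eqVlt => /predU1P[->|lt_ir].
    rewrite X'r; split; first exact: arr_max_in_lattice.
    by move=> Y YL; rewrite (addv_idPr (arr_max_sub YL)).
  by rewrite X'E //; apply/sum_modularD/modX.
have last_part : localization A (X' r.+1) `\` localization A (X' r) = P.
  by rewrite X'r locE // Xr !localization_arr_max fsetDK.
have partE i : (0 < i <= r)%N ->
    localization A (X' i) `\` localization A (X' i.-1) =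
    localization (A `\` P) (X i) `\` localization (A `\` P) (X i.-1).
  by case/andP=> i_gt0 le_ir; rewrite !locE // (leq_trans (leq_pred i)).
apply/fsetP=> Q; apply/idP/mem_imfset_iota=> [piQ|[i lt_i ->]].
  have [->|neq] := eqVneq Q P; first by exists r.+1; rewrite ?leqnn.
  have: Q \in pi `\ P by rewrite !inE neq.
  rewrite defpi => /mem_imfset_iota[i lt_i ->]; exists i; first by lia.
  by rewrite partE //; lia.
have [->|neq] := eqVneq i r.+1; first by rewrite last_part.
have le_i : (0 < i <= r)%N by lia.
suff: localization A (X' i) `\` localization A (X' i.-1) \in pi `\ P.
  by rewrite !inE => /andP[].
by rewrite defpi; apply/mem_imfset_iota; exists i; [lia | apply: partE].
Qed.

End ModularCoatom.

(** * Hyperplanes of a graphical arrangement *)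

Section Hyperplanes.
Variables (K : fieldType) (n : nat).
Implicit Types (S : {set 'I_n}) (i j a b c d : 'I_n).
Local Notation h := (hyperplane K).

Lemma hyperplaneC i j : h i j = h j i.
Proof.
by apply/vspaceP=> x; rewrite !mem_hyperplane !subr_eq0; apply: eq_sym.
Qed.

Definition chi S : 'rV[K]_n := \row_i (i \in S)%:R.

Lemma chi_hyperplane S i j :
  (chi S \in h i j) = ((i \in S) == (j \in S)).
Proof.
rewrite mem_hyperplane !mxE subr_eq0.
by case: (i \in S); case: (j \in S); rewrite ?eqxx ?[0 == _]eq_sym ?oner_eq0.
Qed.

Lemma hyperplane_neq_fullv i j : (h i j != fullv) = (i != j).
Proof.
congr negb; apply/eqP/eqP=> [eqf|->].
  apply/eqP; have := chi_hyperplane [set i] i j.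
  by rewrite eqf memvf !inE eqxx => /esym/eqP/esym; rewrite eq_sym.
by apply/vspaceP=> x; rewrite mem_hyperplane subrr eqxx memvf.
Qed.

Lemma hyperplane_inj a b i j : i != j -> h a b = h i j ->
  (a = i /\ b = j) \/ (a = j /\ b = i).
Proof.
move=> neq_ij eqh.
have T S : ((a \in S) == (b \in S)) = ((i \in S) == (j \in S)).
  by rewrite -!chi_hyperplane eqh.
have Ti : (a == i) != (b == i).
  by have := T [set i]; rewrite !inE eqxx [j == i]eq_sym (negPf neq_ij) => /negbT.
have Tj : (a == j) != (b == j).
  by have := T [set j]; rewrite !inE eqxx (negPf neq_ij) => /negbT.
move: Ti Tj; have [->|_] := eqVneq a i; have [->|_] := eqVneq b i => // _.
  by rewrite (negPf neq_ij); case: (eqVneq b j) => // ->; left.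
by rewrite (negPf neq_ij); case: (eqVneq a j) => // ->; right.
Qed.

Local Opaque hyperplane.

(** The edge ij depends on the edges ab and cd and differs from both, so the
    three edges form a triangle; z is the vertex common to ab and cd. Indicator
    vectors chi S suffice as test vectors, over any field. *)
Lemma hyperplane_triangle a b c d i j :
    a != b -> c != d -> i != j ->
    (h a b :&: h c d <= h i j)%VS -> h i j != h a b -> h i j != h c d ->
  exists z x y, [/\ h a b = h z x, h c d = h z y & h i j = h x y].
Proof.
move=> ab cd ij sub nab ncd.
have T S : (a \in S) = (b \in S) -> (c \in S) = (d \in S) ->
    (i \in S) = (j \in S).
  move=> eab ecd; apply/eqP; rewrite -chi_hyperplane; apply: (subvP sub).
  by rewrite memv_cap !chi_hyperplane eab ecd !eqxx.
have mem k l : k != l ->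
    (forall S, (a \in S) = (b \in S) -> (c \in S) = (d \in S) ->
      (k \in S) = (l \in S)) ->
    (k \in [set a; b]) || (k \in [set c; d]).
  move=> kl Tkl; apply/norP; rewrite !inE !negb_or.
  case=> /andP[ka kb] /andP[kc kd]; have := Tkl [set k].
  rewrite !inE eqxx [a == k]eq_sym [b == k]eq_sym [c == k]eq_sym [d == k]eq_sym.
  rewrite [l == k]eq_sym (negPf ka) (negPf kb) (negPf kc) (negPf kd) (negPf kl).
  by move/(_ erefl erefl).
have pair x y : i \in [set x; y] -> j \in [set x; y] -> h i j = h x y.
  rewrite !inE => /pred2P[ix|ix] /pred2P[jx|jx]; move: ij; rewrite ix jx ?eqxx //.
  by rewrite hyperplaneC.
have core k l : (forall S, (a \in S) = (b \in S) -> (c \in S) = (d \in S) ->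
      (k \in S) = (l \in S)) ->
    k \in [set a; b] -> l \in [set c; d] ->
    k \notin [set c; d] -> l \notin [set a; b] ->
  exists z x y, [/\ h a b = h z x, h c d = h z y & h k l = h x y].
  move=> Tkl kab lcd kcd lab.
  have [z [hz zab]] : exists z, h a b = h z k /\ [set a; b] = [set z; k].
    by move: kab; rewrite !inE => /pred2P[]->; [exists b | exists a];
      rewrite // hyperplaneC setUC.
  have [y [hy ycd]] : exists y, h c d = h y l /\ [set c; d] = [set y; l].
    by move: lcd; rewrite !inE => /pred2P[]->; [exists d | exists c];
      rewrite // hyperplaneC setUC.
  suff zy : z = y by exists z, k, l; rewrite hy -zy.
  have := Tkl [set a; b]; rewrite kab (negPf lab) set21 set22 => /(_ erefl) Tab.
  have cdab : [exists x in [set c; d], x \in [set a; b]].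
    apply: contraTT isT => /exists_inPn Ncd.
    by have := Tab; rewrite (negPf (Ncd c _)) ?(negPf (Ncd d _)) ?set21 ?set22 // => ->.
  case/exists_inP: cdab => x; rewrite ycd => /set2P[]->; last by rewrite (negPf lab).
  rewrite zab => /set2P[] // yk; by rewrite -yk ycd set21 in kcd.
have ki := mem i j ij T.
have kj : (j \in [set a; b]) || (j \in [set c; d]).
  by apply: (mem j i) => [|S eab ecd]; [rewrite eq_sym | rewrite (T S)].
have Nab : ~~ ((i \in [set a; b]) && (j \in [set a; b])).
  by apply: contraNN nab => /andP[] /pair H /H ->.
have Ncd : ~~ ((i \in [set c; d]) && (j \in [set c; d])).
  by apply: contraNN ncd => /andP[] /pair H /H ->.
have [iab|iab] := boolP (i \in [set a; b]).
  move: ki kj Nab Ncd; rewrite iab /= => _ + jab; rewrite (negPf jab) /= => jcd.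
  by rewrite jcd andbT => icd; apply: core.
move: ki kj Nab Ncd; rewrite (negPf iab) /= => icd; rewrite icd /= => + _ jcd.
rewrite (negPf jcd) orbF [h i j]hyperplaneC => jab.
by apply: core => // S eab ecd; rewrite (T S).
Qed.
End Hyperplanes.

Section HyperplaneRank.
Variables (K : fieldType) (n : nat).
Local Notation h := (hyperplane K).

Lemma dim_hyperplane (i j : 'I_n) : (n <= (\dim (h i j)).+1)%N.
Proof.
have := limg_ker_dim (linfun (@coord_diff K n i j)) fullv.
rewrite capfv dimvf /dim /= mul1n -/(hyperplane K i j) => dimn.
have : (\dim (limg (linfun (@coord_diff K n i j))) <= 1)%N.
  by apply: leq_trans (dimvS (subvf _)) _; rewrite dimvf.
by move: dimn; set x := \dim _; set y := \dim (limg _); lia.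
Qed.

Lemma rk_bigcap_hyperplane m (f g : 'I_m -> 'I_n) :
  (rk (\bigcap_(i < m) h (f i) (g i))%VS <= m)%N.
Proof.
elim: m f g => [|m IHm] f g.
  by rewrite big_ord0 /rk dimvf /dim /= mul1n subnn.
rewrite big_ord_recl; set U := (\bigcap_(i < m) _)%VS.
have := dimv_sum_cap (h (f ord0) (g ord0)) U; rewrite addnC.
have := dim_hyperplane (f ord0) (g ord0); have := IHm _ _ : (rk U <= m)%N.
have := dimv_le (h (f ord0) (g ord0) + U)%VS; rewrite /rk.
set s := \dim (_ + _); set u := \dim U; set a := \dim _; set b := \dim _.
lia.
Qed.

(** The equations along the first m - 1 steps of a closed walk imply the one of
    the last step, so the rank is at most m - 1. *)
Lemma closed_walk_dependent m (q : nat -> 'I_n) :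
  (0 < m)%N -> q m = q 0%N ->
  ~ independent_tuple [tuple h (q i) (q i.+1) | i < m].
Proof.
case: m => // m _ closed indep.
suff : (rk (\bigcap_(i < m.+1) tnth [tuple h (q i) (q i.+1) | i < m.+1] i)%VS <= m)%N.
  by rewrite indep ltnn.
under eq_bigr do rewrite tnth_mktuple.
rewrite big_ord_recr /= (capv_idPl _).
  exact: rk_bigcap_hyperplane (fun i : 'I_m => q i) (fun i : 'I_m => q i.+1).
apply/subvP=> x /[!memvE] /subv_bigcapP xq.
have {xq} xq i : (i <= m)%N -> x 0 (q i) = x 0 (q 0%N).
  elim: i => // i IHi lt_im; rewrite -IHi 1?ltnW //.
  have := xq (Ordinal lt_im) isT.
  by rewrite -memvE mem_hyperplane subr_eq0 => /eqP.
by rewrite -memvE mem_hyperplane closed xq ?subrr.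
Qed.

End HyperplaneRank.

(** * Nice partitions of the edges of a graph *)

(** The vertex sequence is a function on nat, of which only the values at
    0, ..., m matter, so that subwalks are obtained by shifting. *)
Definition walk (T : Type) (e : rel T) m x y :=
  exists q : nat -> T,
    [/\ q 0%N = x, q m = y & forall i, (i < m)%N -> e (q i) (q i.+1)].

Lemma walk_cat (T : Type) (e : rel T) m1 m2 x y z :
  walk e m1 x y -> walk e m2 y z -> walk e (m1 + m2) x z.
Proof.
move=> [q1 [q10 q1m w1]] [q2 [q20 q2m w2]].
exists (fun i => if (i < m1)%N then q1 i else q2 (i - m1)%N); split.
- by case: ltnP => // ; rewrite leqn0 => /eqP m0; rewrite m0 q20 -q1m m0.
- by rewrite ltnNge leq_addr addKn.
move=> i lt_i; case: (ltnP i m1) => [lt_im|le_mi].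
  case: ltnP => [_|le_mi]; first exact: w1.
  have eqm : i.+1 = m1 by lia.
  by rewrite eqm subnn q20 -q1m -eqm w1.
by rewrite ltnNge leqW //= subSn // w2 //; lia.
Qed.

Lemma connect_walk (T : finType) (e : rel T) x y :
  connect e x y -> exists m, walk e m x y.
Proof.
case/connectP=> p /(pathP x) ep ->; exists (size p), (nth x (x :: p)).
by split=> //; rewrite -last_nth.
Qed.

Lemma part_sub (K : fieldType) (n : nat) (A P : {fset subspace K n})
    (pi : {fset {fset subspace K n}}) :
  nice_partition A pi -> P \in pi -> P `<=` A.
Proof.
by case=> -[_ _ <-] _ _ piP; apply: (bigfcup_sup (fun Q => Q)).
Qed.

Section NicePartition.
Variables (K : fieldType) (n : nat) (E : rel 'I_n).
Hypotheses (E_sym : symmetric E) (E_irr : irreflexive E).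
Variable pi : {fset {fset subspace K n}}.
Implicit Types P Q : {fset subspace K n}.

Local Notation h := (hyperplane K).
Local Notation A := (graphical_arrangement K E).
Local Opaque hyperplane.

Lemma edge_neq i j : E i j -> i != j.
Proof. by apply: contraTneq => ->; rewrite E_irr. Qed.

Lemma mem_graphical i j : (h i j \in A) = E i j.
Proof.
apply/graphical_arrangementP/idP=> [[k [l [Ekl eqh]]]|Eij]; last by exists i, j.
have [[-> ->] //|[-> ->]] := hyperplane_inj (edge_neq Ekl) eqh.
by rewrite E_sym.
Qed.

Hypothesis nice : nice_partition A pi.

Let part_exists H : H \in A -> exists2 P, P \in pi & H \in P.
Proof.
by case: nice => -[_ _ <-] _ _ /bigfcupP[P /andP[piP _] PH]; exists P.
Qed.

Let part_uniq P Q H : P \in pi -> Q \in pi -> H \in P -> H \in Q -> P = Q.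
Proof.
case: nice => -[_ dis _] _ _ piP piQ HP HQ; apply/eqP; apply: contraTT HQ => neq.
by have /fdisjointP := dis _ _ piP piQ neq; apply.
Qed.

Let part_edge P i j : P \in pi -> h i j \in P -> E i j.
Proof. by move=> /(part_sub nice)/fsubsetP sPA /sPA; rewrite mem_graphical. Qed.

(** Niceness at the rank 2 flat spanned by the two edges: some part contains
    exactly one of the edges of this flat, so not all of them lie in P. An
    edge outside P must close a triangle. *)
Lemma part_triangle P a b c d :
    P \in pi -> h a b \in P -> h c d \in P -> h a b != h c d ->
  exists z x y, [/\ h a b = h z x, h c d = h z y, E x y & h x y \notin P].
Proof.
move=> piP Pab Pcd neq; set X := (h a b :&: h c d)%VS.
have /fsubsetP sPA := part_sub nice piP.
have [Aab Acd] := (sPA _ Pab, sPA _ Pcd).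
have [Eab Ecd] := (part_edge piP Pab, part_edge piP Pcd).
have ab : h a b \in localization A X by rewrite mem_localization Aab capvSl.
have cd : h c d \in localization A X by rewrite mem_localization Acd capvSr.
have XL : X \in inter_lattice A.
  apply/mem_inter_lattice; exists [fset h a b; h c d].
    by apply/fsubsetP=> H /fset2P[]->.
  by rewrite big_fsetU1 ?inE //= big_seq_fset1.
have Xneq : X != fullv.
  apply: contraTneq (edge_neq Eab) => Xf; rewrite -(hyperplane_neq_fullv K) negbK.
  by rewrite eqEsubv subvf -Xf capvSl.
have [_ _ /(_ X XL Xneq)[Q [piQ /eqP/cardfs1P[H1 defQ]]]] := nice.
(* An edge of the flat outside P, if there is one, closes a triangle. *)
have [|sXP] := boolP [exists ij : 'I_n * 'I_n,
   [&& E ij.1 ij.2, (X <= h ij.1 ij.2)%VS & h ij.1 ij.2 \notin P]].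
  case/existsP=> -[i j] /= /and3P[Eij sXij nPij].
  have [||z [x [y [eab ecd eij]]]] :=
    hyperplane_triangle (edge_neq Eab) (edge_neq Ecd) (edge_neq Eij) sXij.
  - by apply: contraNneq nPij => ->.
  - by apply: contraNneq nPij => ->.
  by exists z, x, y; rewrite -eij -mem_graphical -eij mem_graphical.
have H1Q : H1 \in Q `&` localization A X by rewrite defQ inE.
move: H1Q; rewrite inE mem_localization => /and3P[QH1 AH1 sXH1].
have PH1 : H1 \in P.
  have /graphical_arrangementP[i [j [Eij eqH1]]] := AH1.
  apply: contraNT sXP => nPH1; apply/existsP; exists (i, j) => /=.
  by rewrite Eij -eqH1 sXH1.
have defP : Q = P by apply: part_uniq QH1 PH1.
have H1eq H : H \in P -> H \in localization A X -> H = H1.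
  by move=> PH XH; apply/fset1P; rewrite -defQ inE defP PH.
by move: neq; rewrite (H1eq _ Pab ab) (H1eq _ Pcd cd) eqxx.
Qed.

(** Steps in pairwise different parts would form a section, contradicting
    independence by [closed_walk_dependent]. *)
Lemma no_rainbow_closed_walk m (q : nat -> 'I_n) :
    (0 < m)%N -> q m = q 0%N -> (forall i, (i < m)%N -> E (q i) (q i.+1)) ->
  exists P i j, [/\ P \in pi, (i < j < m)%N, h (q i) (q i.+1) \in P
                  & h (q j) (q j.+1) \in P].
Proof.
move=> m_gt0 closed walk.
pose rep (ij : 'I_m * 'I_m) (P : {fset subspace K n}) :=
  [&& (ij.1 < ij.2)%N, h (q ij.1) (q ij.1.+1) \in P & h (q ij.2) (q ij.2.+1) \in P].
have [/existsP[[i j] /hasP[P piP /and3P[/= lt_ij Pi Pj]]]|norep] :=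
    boolP [exists ij, has (rep ij) pi].
  by exists P, i, j; rewrite lt_ij ltn_ord.
case: (closed_walk_dependent (K := K) m_gt0 closed).
have [_ indep _] := nice; apply: indep.
have edge (i : 'I_m) : h (q i) (q i.+1) \in A by rewrite mem_graphical walk.
split=> [i|i j neq_ij]; rewrite ?tnth_mktuple //.
have [P piP Pi] := part_exists (edge i); have [Q piQ Qj] := part_exists (edge j).
exists P, Q; split=> //; apply: contraNneq norep => defP; subst Q.
apply/existsP; case: (ltngtP i j) => [lt_ij|lt_ji|/val_inj eq_ij].
- by exists (i, j); apply/hasP; exists P; rewrite // /rep lt_ij Pi Qj.
- by exists (j, i); apply/hasP; exists P; rewrite // /rep lt_ji Pi Qj.
- by rewrite eq_ij eqxx in neq_ij.
Qed.

(** If the parts do come from a modular chain, then Q comes after P in the chain: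
    of the edges of a triangle, two enter the chain together and last. *)
Definition triangle_above P Q p := [exists u, exists w,
  [&& h p u \in Q, h p w \in Q, u != w & h u w \in P]].

(** Take a shortest walk outside P joining the ends of an edge of P. The closed
    walk that it forms with this edge is not rainbow, so two steps of the walk
    lie in one part Q; by [part_triangle] and minimality they are consecutive,
    and the third edge of their triangle is a shortcut unless it belongs to P. *)
Lemma triangle_above_of_walk P u w m :
    P \in pi -> h u w \in P -> walk [rel i j | E i j && (h i j \notin P)] m u w ->
  exists Q p, Q \in pi /\ triangle_above P Q p.
Proof.
move=> piP Puw; elim/ltn_ind: m => m IHm [q [q0 qm walkq]].
set e := [rel i j | _] in IHm walkq.
have edgeq i : (i < m)%N -> E (q i) (q i.+1) /\ h (q i) (q i.+1) \notin P.
  by move/walkq/andP.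
have sub i j : (i <= j <= m)%N -> walk e (j - i) (q i) (q j).
  case/andP=> le_ij le_jm; exists (fun k => q (i + k)%N).
  split=> [||k lt_k]; rewrite ?addn0 ?subnKC ?addnS //.
  by apply: walkq; lia.
(* A shortcut between two vertices of the walk lets the induction apply. *)
have shorten i j k : (i <= j <= m)%N -> walk e k (q i) (q j) -> (k < j - i)%N ->
    exists Q p, Q \in pi /\ triangle_above P Q p.
  move=> le_ij wk lt_k; apply: (IHm (i + (k + (m - j)))%N); first by lia.
  have := walk_cat (sub 0%N i _) (walk_cat wk (sub j m _)).
  by rewrite q0 qm subn0; apply; lia.
have repeat i j : (i < j <= m)%N -> q i = q j ->
    exists Q p, Q \in pi /\ triangle_above P Q p.
  move=> lt_ij eqq; apply: (shorten i j 0%N); try lia.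
  by exists (fun=> q i).
(* The walk is closed by one more step, from w back to u. *)
pose q' i := if (i <= m)%N then q i else u.
have [||i lt_im|Q [a [b [piQ]]]] := @no_rainbow_closed_walk m.+1 q' => //.
- by rewrite /q' ltnn leq0n.
- rewrite /q' -ltnS lt_im; case: ltnP => [lt_im'|le_mi].
    by case: (edgeq i lt_im').
  have -> : i = m by lia.
  by rewrite qm E_sym (part_edge piP).
case/andP=> lt_ab; rewrite ltnS leq_eqVlt /q' => /predU1P[eq_bm|lt_bm].
  rewrite eq_bm leqnn ltnn qm in lt_ab *; rewrite ltnW // lt_ab => Qa.
  rewrite hyperplaneC => Quw; have eqPQ := part_uniq piP piQ Puw Quw.
  by have [_ /negP[]] := edgeq _ lt_ab; rewrite eqPQ.
have [r1 r2 r3] : [/\ a < b <= m, a < b.+1 <= m & a.+1 < b.+1 <= m]%N by split; lia.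
have r4 : (a.+1 < b)%N -> (a.+1 < b <= m)%N by lia.
have r5 : (b <= a.+1)%N -> b = a.+1 by lia.
have r6 : (a <= b.+1 <= m)%N /\ (1 < b.+1 - a)%N by split; lia.
rewrite !ifT; try lia.
move=> Qa Qb; have [eab|neq] := eqVneq (h (q a) (q a.+1)) (h (q b) (q b.+1)).
  have [[eqq _]|[eqq _]] := hyperplane_inj (edge_neq (part_edge piQ Qb)) eab.
    exact: repeat r1 eqq.
  exact: repeat r2 eqq.
have [z [x [y [ea eb Exy nQxy]]]] := part_triangle piQ Qa Qb neq.
have Qzx := Qa; have Qzy := Qb; rewrite ea in Qzx; rewrite eb in Qzy.
have [[za xa]|[za xa]] := hyperplane_inj (edge_neq (part_edge piQ Qzx)) ea.
  have [[zb yb]|[zb yb]] := hyperplane_inj (edge_neq (part_edge piQ Qzy)) eb.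
    by apply: (repeat a b r1); rewrite za zb.
  by apply: (repeat a b.+1 r2); rewrite za yb.
have [[zb yb]|[zb yb]] := hyperplane_inj (edge_neq (part_edge piQ Qzy)) eb; last first.
  by apply: (repeat a.+1 b.+1 r3); rewrite xa yb.
have [/r4 lt|/r5 eq_ab] := ltnP a.+1 b.
  by apply: (repeat a.+1 b lt); rewrite xa zb.
have [Pxy|nPxy] := boolP (h x y \in P).
  exists Q, z; split=> //; apply/existsP; exists x; apply/existsP; exists y.
  by rewrite Qzx Qzy (edge_neq Exy).
case: r6 => le_ab lt_1; apply: (shorten a b.+1 1%N) => //.
exists (fun k => if k is 0 then q a else q b.+1); split=> // k; rewrite ltnS leqn0.
by move=> /eqP->; rewrite /= za yb Exy.
Qed.

(** A part with more than one edge is a star: any two edges of P share a vertex,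
    and three edges of P never form a triangle. *)
Lemma mem_center P u w p a b :
    P \in pi -> h u w \in P -> h p a \in P -> h p b \in P -> a != b ->
  p \in [set u; w].
Proof.
move=> piP Puw Ppa Ppb neq_ab.
have step c : h p c \in P -> (p \in [set u; w]) || (c \in [set u; w]).
  move=> Ppc; have [euw|neq] := eqVneq (h p c) (h u w).
    have [[-> _]|[-> _]] := hyperplane_inj (edge_neq (part_edge piP Puw)) euw.
      by rewrite set21.
    by rewrite set22.
  have [z [x [y [epc euw _ _]]]] := part_triangle piP Ppc Puw neq.
  have zuw : z \in [set u; w].
    have [[-> _]|[-> _]] := hyperplane_inj (edge_neq (part_edge piP Puw)) (esym euw).
      by rewrite set21.
    by rewrite set22.
  have [[<- _]|[<- _]] := hyperplane_inj (edge_neq (part_edge piP Ppc)) (esym epc).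
    by rewrite zuw.
  by rewrite zuw orbT.
have [//|npuw] := boolP (p \in _).
have := step a Ppa; have := step b Ppb; rewrite (negPf npuw) /= => buw auw.
have Pab : h a b \in P.
  move: auw buw neq_ab; rewrite !inE => /pred2P[]-> /pred2P[]->; rewrite ?eqxx //.
  by rewrite hyperplaneC.
have pa := edge_neq (part_edge piP Ppa); have pb := edge_neq (part_edge piP Ppb).
have neq : h p a != h p b.
  apply: contraNneq neq_ab => /(hyperplane_inj pb)[[_ ->]|[_ eqap]] //.
  by rewrite eqap eqxx in pa.
have [z [x [y [ea eb _ /negP[]]]]] := part_triangle piP Ppa Ppb neq.
have [[z1 x1]|[z1 x1]] := hyperplane_inj pa (esym ea);
  have [[z2 y2]|[z2 y2]] := hyperplane_inj pb (esym eb).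
- by rewrite x1 y2.
- by rewrite -z1 z2 eqxx in pb.
- by rewrite -z2 z1 eqxx in pa.
- by rewrite -z1 z2 eqxx in neq_ab.
Qed.

(** Otherwise each part P has a part f P above it, with apex g P. Both edges at
    g P lie in f P, so g P is the centre of the star f P, hence an end of the
    edge of f P that is opposite to g (f P). Along a cycle of f, the apexes
    thus form a closed walk whose steps lie in pairwise different parts. *)
Lemma exists_topmost_part : pi != fset0 ->
  exists2 P, P \in pi & forall Q p, Q \in pi -> ~~ triangle_above P Q p.
Proof.
move=> /fset0Pn[P0 piP0].
have [/existsP[P /forallP uncr]|] :=
    boolP [exists P : pi, [forall Qp : pi * 'I_n,
      ~~ triangle_above (val P) (val Qp.1) Qp.2]].
  exists (val P); first exact: valP.
  by move=> Q p piQ; apply: (uncr ([` piQ], p)).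
move/existsPn=> no_topmost.
have /fin_all_exists[F aboveF] (P : pi) :
    exists Qp : pi * 'I_n, triangle_above (val P) (val Qp.1) Qp.2.
  by have /forallPn[Qp /negPn] := no_topmost P; exists Qp.
pose f (P : pi) := (F P).1; pose g (P : pi) := (F P).2.
have edge (P : pi) : h (g P) (g (f P)) \in val (f (f P)).
  have /existsP[u /existsP[w /and4P[pu pw neq _]]] := aboveF P.
  have /existsP[u' /existsP[w' /and4P[pu' pw' _ uw']]] := aboveF (f P).
  have := mem_center (valP (f P)) uw' pu pw neq.
  by rewrite hyperplaneC /g => /set2P[]->.
(* Iterating f on a finite type reaches a periodic point; its least period k
   makes the k parts met along the cycle distinct. *)
have [y [d [d_gt0 per]]] : exists y d, (0 < d)%N /\ iter d f y = y.
  have /trajectP[i lt_i eq_i] := looping_order f [` piP0].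
  exists (iter i f [` piP0]), (fingraph.order f [` piP0] - i)%N.
  by rewrite subn_gt0 lt_i -iterD subnK // ltnW.
have [k /andP[k_gt0 /eqP per_k] min_k] : exists2 k, (0 < k)%N && (iter k f y == y) &
    forall m, (0 < m)%N && (iter m f y == y) -> (k <= m)%N.
  have ex : exists k, (0 < k)%N && (iter k f y == y).
    by exists d; rewrite d_gt0 per eqxx.
  by case: (ex_minnP ex) => k; exists k.
have [|i lt_i|Q [i [j [piQ /andP[lt_ij lt_jk] Qi Qj]]]] :=
    @no_rainbow_closed_walk k (fun i => g (iter i f y)) k_gt0.
- by rewrite per_k.
- by rewrite iterS; apply: part_edge (valP _) (edge _).
have eq_f : iter i.+2 f y = iter j.+2 f y.
  apply: val_inj; apply: (@part_uniq _ _ (h (g (iter i f y)) (g (iter i.+1 f y)))).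
  - exact: valP.
  - exact: valP.
  - exact: edge.
  - by rewrite (part_uniq (valP _) piQ (edge (iter j f y)) Qj).
(* Completing i + 2 steps to a multiple of the period cancels them. *)
have perM m : iter (m * k) f y = y by elim: m => // m IHm; rewrite mulSn iterD IHm.
have : (k <= j - i)%N.
  apply: min_k; rewrite subn_gt0 lt_ij /=; apply/eqP.
  have le : (i.+2 <= i.+2 * k)%N by rewrite leq_pmulr.
  have : iter (i.+2 * k - i.+2 + i.+2) f y = iter (i.+2 * k - i.+2 + j.+2) f y.
    by rewrite iterD eq_f -iterD.
  have -> : (i.+2 * k - i.+2 + j.+2 = j - i + i.+2 * k)%N by lia.
  by rewrite subnK // iterD perM => <-.
lia.
Qed.

End NicePartition.

Section CutPart.
Variables (K : fieldType) (n : nat).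
Local Notation h := (hyperplane K).

Lemma hyperplane_addv_line (i j : 'I_n) (v : 'rV[K]_n) :
  v \notin h i j -> (h i j + <[v]>)%VS = fullv.
Proof.
rewrite mem_hyperplane => v_neq0; apply/eqP; rewrite eqEsubv subvf /=.
apply/subvP=> x _; pose c := (x 0 i - x 0 j) / (v 0 i - v 0 j).
(* c is chosen so that x - c v lies on the hyperplane. *)
rewrite -[x](subrK (c *: v)) memv_add ?memvZ ?memv_line //.
rewrite mem_hyperplane !mxE opprD addrACA -opprD -mulrBr.
by rewrite divfK // subrr.
Qed.

Local Opaque hyperplane.

(** S is the component, outside P, of one end u of an edge uw of P. It does not
    contain w, since a walk would produce a part above P; every other edge of P
    spans with uw a triangle whose third edge avoids P, so it leaves S too. *)
Lemma topmost_part_cut (E : rel 'I_n) (E_sym : symmetric E) (E_irr : irreflexive E)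
    (pi : {fset {fset subspace K n}}) (P : {fset subspace K n}) :
    nice_partition (graphical_arrangement K E) pi -> P \in pi ->
    (forall Q p, Q \in pi -> ~~ triangle_above P Q p) ->
  exists S : {set 'I_n}, forall i j, E i j ->
    (h i j \in P) = ((i \in S) != (j \in S)).
Proof.
move=> nice piP topmost.
have sPA := part_sub nice piP.
have [H0 PH0] : exists H, H \in P.
  by apply/fset0Pn; case: nice => -[pi0 _ _] _ _; apply: contraNneq pi0 => <-.
have /graphical_arrangementP[u [w [Euw eqH0]]] := fsubsetP sPA _ PH0.
rewrite {H0}eqH0 in PH0.
set e := [rel i j | E i j && (h i j \notin P)].
have e_sym : connect_sym e.
  by apply: sym_connect_sym => i j; rewrite /= E_sym hyperplaneC.
exists [set k | connect e u k] => i j Eij; rewrite !inE.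
have side k l : E k l -> h k l \notin P -> connect e u k = connect e u l.
  move=> Ekl nPkl; have ekl : connect e k l by apply: connect1; rewrite /= Ekl.
  by rewrite ![connect e u _]e_sym (same_connect e_sym ekl).
have separated : ~~ connect e u w.
  apply/negP=> /connect_walk[m wuw].
  have [Q [p [piQ]]] := triangle_above_of_walk E_sym E_irr nice piP PH0 wuw.
  by apply/negP/topmost.
have sepP k l z : h u w = h k z -> connect e u k = connect e u l ->
    connect e u l != connect e u z.
  move=> euw <-; have neq_uw := edge_neq E_irr Euw.
  by have [[-> ->]|[-> ->]] := hyperplane_inj neq_uw (esym euw);
    rewrite connect0 (negPf separated).
have [Pij|nPij] := boolP (h i j \in P); last by rewrite (side i j) ?eqxx.
symmetry; have [eqij|neq] := eqVneq (h u w) (h i j); first exact: sepP eqij erefl.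
have [z [x [y [euw eij Exy nPxy]]]] := part_triangle E_sym E_irr nice piP PH0 Pij neq.
have yz : connect e u y != connect e u z.
  by apply: sepP (side x y Exy nPxy); rewrite euw hyperplaneC.
have neq_ij := edge_neq E_irr Eij.
by have [[<- <-]|[<- <-]] := hyperplane_inj neq_ij (esym eij); rewrite // eq_sym.
Qed.

Lemma exists_modular_cut (E : rel 'I_n) (pi : {fset {fset subspace K n}}) :
    symmetric E -> irreflexive E ->
    nice_partition (graphical_arrangement K E) pi -> pi != fset0 ->
  exists2 P, P \in pi & exists v, modular_cut (graphical_arrangement K E) P v.
Proof.
move=> E_sym E_irr nice pi_neq0.
have [P piP topmost] := exists_topmost_part E_sym E_irr nice pi_neq0.
exists P => //; have [S cutS] := topmost_part_cut E_sym E_irr nice piP topmost.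
have sPA := part_sub nice piP.
have edgeP H : H \in graphical_arrangement K E ->
    exists i j, [/\ E i j, H = h i j & (h i j \in P) = (chi K S \notin h i j)].
  case/graphical_arrangementP=> i [j [Eij ->]]; exists i, j.
  by rewrite chi_hyperplane cutS.
exists (chi K S); split=> //.
- by apply: contraTneq piP => ->; case: nice => -[].
- move=> H; rewrite inE => /andP[nPH /edgeP[i [j [_ eqH PE]]]].
  by move: nPH; rewrite eqH PE negbK.
- move=> H PH; have [i [j [_ eqH PE]]] := edgeP H (fsubsetP sPA _ PH).
  have nH : chi K S \notin H by rewrite eqH -PE -eqH.
  by split=> //; rewrite eqH hyperplane_addv_line // -eqH.
move=> H1 H2 PH1 PH2.
have [a [b [_ eqH1 _]]] := edgeP H1 (fsubsetP sPA _ PH1).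
have [c [d [_ eqH2 _]]] := edgeP H2 (fsubsetP sPA _ PH2).
rewrite eqH1 eqH2 in PH1 PH2 * => neq.
have [z [x [y [-> -> Exy nPxy]]]] := part_triangle E_sym E_irr nice piP PH1 PH2 neq.
exists (h x y); first by rewrite inE nPxy mem_graphical.
split; apply/subvP=> f; rewrite memv_cap !mem_hyperplane !subr_eq0.
  by case/andP=> /eqP-> /eqP->.
by case/andP=> /eqP-> /eqP->.
Qed.

(** Induction on the number of parts: for a cut P, the arrangement A \ P is again
    graphical and the remaining parts form a nice partition of it. *)
Lemma exists_modular_filtration (E : rel 'I_n) (pi : {fset {fset subspace K n}}) :
    symmetric E -> irreflexive E ->
    nice_partition (graphical_arrangement K E) pi ->
  exists X : nat -> subspace K n,
    modular_filtration (graphical_arrangement K E) pi X.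
Proof.
have [m] := ubnP #|` pi|; elim: m => // m IHm in E pi *.
rewrite ltnS => le_pi E_sym E_irr nice.
have [pi0|pi_neq0] := eqVneq pi fset0.
  have A0 : graphical_arrangement K E = fset0.
    by case: nice => -[_ _ <-] _ _; rewrite pi0 /fcover big_seq_fset0.
  have T0 : arr_max (graphical_arrangement K E) = fullv.
    by rewrite /arr_max A0 big_seq_fset0.
  have r0 : arr_rank (graphical_arrangement K E) = 0%N.
    by rewrite /arr_rank T0 /rk dimvf /dim /= mul1n subnn.
  exists (fun=> fullv); split; rewrite ?T0 ?r0 //.
    move=> i _; split=> [|Y YL]; first exact: fullv_in_lattice.
    by rewrite (addv_idPl (subvf Y)) fullv_in_lattice.
  by rewrite pi0; apply/fsetP=> Q; rewrite inE; apply/esym/mem_imfset_iota=> -[i]; lia.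
have [P piP [v cutP]] := exists_modular_cut E_sym E_irr nice pi_neq0.
pose E' := [rel i j | E i j && (h i j \notin P)].
have defA' : graphical_arrangement K E `\` P = graphical_arrangement K E'.
  apply/fsetP=> H; rewrite inE; apply/andP/graphical_arrangementP.
    case=> nPH /graphical_arrangementP[i [j [Eij eqH]]].
    by exists i, j; rewrite /= Eij -eqH.
  case=> i [j [/andP[Eij nPij] ->]]; split=> //.
  by apply/graphical_arrangementP; exists i, j.
have nice' := nice_partition_coatom cutP piP nice.
rewrite defA' in nice'.
have [|||X filX] := IHm E' (pi `\ P) _ _ _ nice'.
- by move: le_pi; rewrite (cardfsD1 P) piP.
- by move=> i j; rewrite /= E_sym hyperplaneC.
- by move=> i; rewrite /= E_irr.
by apply: (modular_filtration_coatom cutP piP (X := X)); rewrite defA'.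
Qed.

End CutPart.

Theorem theorem1p2 (K : fieldType) (n : nat) (E : rel 'I_n)
    (E_sym : symmetric E) (E_irr : irreflexive E)
    (pi : {fset {fset subspace K n}}) :
  let A := graphical_arrangement K E in
  nice_partition A pi ->
  exists X : nat -> subspace K n,
    maximal_modular_chain A X /\
    pi = [fset localization A (X i) `\` localization A (X i.-1)
           | i in iota 1 (arr_rank A)].
Proof.
move=> A nice.
have [X [X0 Xr ltX modX defpi]] := exists_modular_filtration E_sym E_irr nice.
exists X; split=> //; split=> //; last by move=> i /modX/sum_modular_modular.
by apply: strict_chain_maximal => // i /modX[].
Qed.
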